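(* Let $p$ be a prime number, $q$ a power of $p$, and $n\geq 2$ an integer such that $n_q\leq\sqrt{q}$ (with $n_q$ as defined in the context). Let $E$ be an elliptic curve over $\mathbb{F}_q$, $t\in E(\mathbb{F}_q)$ a point of order $n$, $R\in E(\mathbb{F}_q)$ a point with $nR\neq O$, and $\mathfrak{a},\mathfrak{b}\in\mathbb{F}_q$ scalars with $\mathfrak{a}\neq 0$ and $\mathfrak{a}\mathfrak{c}+n\mathfrak{b}=1$, giving rise to the vectors $\overrightarrow{\mathcal{R}}$, $\overrightarrow{\mathcal{R}}_x$ and $\overleftarrow{\mathcal{R}}_k$ of the context. Then $$w(\overrightarrow{\mathcal{R}}_x)\geq n-2,\qquad w(\overrightarrow{\mathcal{R}})\geq n-2,$$ and, for every $0\leq k\leq n-1$, $$w(\overleftarrow{\mathcal{R}}_k)\geq\begin{cases} n-2, & \text{if } \overrightarrow{\mathcal{R}} \text{ has exactly one zero entry},\\ n-4, & \text{if } \overrightarrow{\mathcal{R}} \text{ has exactly two zero entries}.\end{cases}$$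
   Context: **The integer $n_q$.** For a prime $l$ let $v_l$ be the $l$-adic valuation. Given $n$ and $q$, $n_q$ is the unique positive integer such that for every prime $l$: $v_l(n_q)=v_l(n)$ if $l$ is coprime to $q-1$; $v_l(n_q)=0$ if $v_l(n)=0$; and $v_l(n_q)=\max\{2v_l(q-1)+1,\,2v_l(n)\}$ if $l\mid q-1$ and $l\mid n$. **Elliptic functions.** $E$ is given by a Weierstrass equation $y^2+a_1xy+a_3y=x^3+a_2x^2+a_4x+a_6$ over $\mathbb{F}_q$ with identity element $O$; $x(P),y(P)$ denote the coordinates of a point $P\neq O$. For distinct points $A,B$ of $E$, $f_{A,B}$ is the function on $E$ $$f_{A,B}(P)=\frac{y(P-A)-y(A-B)}{x(P-A)-x(A-B)},$$ which has exactly two poles, $A$ and $B$. For $t\in E(\mathbb{F}_q)$ of order $n$, the function $\sum_{k=0}^{n-1} f_{kt,(k+1)t}$ is a constant (known fact), denoted $\mathfrak{c}\in\mathbb{F}_q$. **Vectors.** Vectors in $\mathbb{F}_q^n$ have indices modulo $n$. Set $\overrightarrow{\mathcal{R}}=(r_j)_{0\leq j\leq n-1}$ with $r_j=\mathfrak{a}\,f_{O,t}(R+jt)+\mathfrak{b}$; $\overrightarrow{\mathcal{R}}_x=(x(R+jt))_{0\leq j\leq n-1}$; and $\overleftarrow{\mathcal{R}}_k=(r_j\,r_{j-k})_{0\leq j\leq n-1}$, the component-wise product of $\overrightarrow{\mathcal{R}}$ with its $k$-th cyclic shift. The weight $w(\overrightarrow{v})$ is the number of nonzero entries of $\overrightarrow{v}$.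 *)

(* Defs.v *)
From mathcomp Require Import all_boot all_order all_algebra all_field.

Set Implicit Arguments.
Unset Strict Implicit.
Unset Printing Implicit Defensive.

Import Order.TTheory GRing.Theory Num.Theory.

(* The integer n_q; it is characterized by its valuations, see [n_qP] and
   [n_q_unique]. *)
Definition n_q_val (n q l : nat) : nat :=
  if l %| q - 1 then maxn (2 * logn l (q - 1) + 1) (2 * logn l n)
  else logn l n.

Definition n_q (n q : nat) : nat := \prod_(l <- primes n) l ^ n_q_val n q l.

Definition n_q_spec (n q m : nat) : Prop :=
  0 < m /\
  forall l, prime l ->
    [/\ coprime l (q - 1) -> logn l m = logn l n,
        logn l n = 0 -> logn l m = 0
      & l %| q - 1 -> l %| n ->
        logn l m = maxn (2 * logn l (q - 1) + 1) (2 * logn l n)].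

Lemma logn_prod_primes (s : seq nat) (e : nat -> nat) (l : nat) :
  uniq s -> all prime s ->
  0 < \prod_(i <- s) i ^ e i /\
  logn l (\prod_(i <- s) i ^ e i) = if l \in s then e l else 0.
Proof.
elim: s => [|i s IHs] /=; first by rewrite big_nil logn1.
case/andP=> nis us /andP[pi ps]; have [gt0 IH] := IHs us ps.
have igt0 : 0 < i ^ e i by rewrite expn_gt0 prime_gt0.
rewrite big_cons; split; first by rewrite muln_gt0 igt0.
rewrite lognM // lognX logn_prime // IH inE.
by case: eqVneq => [->|_]; rewrite ?(negPf nis) ?muln0 ?muln1 ?addn0.
Qed.

Lemma n_qP (n q : nat) : 0 < n -> n_q_spec n q (n_q n q).
Proof.
move=> n_gt0; have ap : all prime (primes n).
  by apply/allP=> i; rewrite mem_primes => /andP[].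
have E l := logn_prod_primes (n_q_val n q) l (primes_uniq n) ap.
split=> [|l pl]; first by case: (E 0).
have [_ El] := E l; rewrite -/(n_q n q) in El.
rewrite El mem_primes pl n_gt0 /= /n_q_val; split.
- rewrite prime_coprime // => /negPf ->.
  by case: ifP => // /negbT nd; rewrite logn_coprime // prime_coprime.
- move=> v0; case: ifP => // ln.
  have : 0 < logn l n by rewrite logn_gt0 mem_primes pl n_gt0.
  by rewrite v0.
- by move=> -> ->.
Qed.

Lemma n_q_unique (n q m m' : nat) :
  0 < n -> n_q_spec n q m -> n_q_spec n q m' -> m = m'.
Proof.
move=> n_gt0 [m_gt0 Hm] [m'_gt0 Hm']; apply: eqn_from_log => // l.
have [pl|npl] := boolP (prime l); last by rewrite lognE [RHS]lognE (negPf npl).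
have [c1 z1 d1] := Hm l pl; have [c2 z2 d2] := Hm' l pl.
have [lq|] := boolP (l %| q - 1); last first.
  by rewrite -prime_coprime // => co; rewrite c1 ?c2.
have [ln|ln] := boolP (l %| n); first by rewrite d1 ?d2.
by rewrite z1 ?z2 // logn_coprime // prime_coprime.
Qed.

Local Open Scope ring_scope.

(* The Weierstrass equation y^2 + a1 x y + a3 y = x^3 + a2 x^2 + a4 x + a6. *)
Record weierstrass (K : Type) := Weierstrass {
  wa1 : K; wa2 : K; wa3 : K; wa4 : K; wa6 : K }.

(* [None] is the point at infinity, i.e. the identity element O. *)
Definition point (K : Type) : Type := option (K * K).

Section Curve.
Variables (K : fieldType) (E : weierstrass K).
Local Notation a1 := (wa1 E).
Local Notation a2 := (wa2 E).
Local Notation a3 := (wa3 E).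
Local Notation a4 := (wa4 E).
Local Notation a6 := (wa6 E).

Definition discriminant : K :=
  let b2 := a1 ^+ 2 + 4 * a2 in
  let b4 := 2 * a4 + a1 * a3 in
  let b6 := a3 ^+ 2 + 4 * a6 in
  let b8 := a1 ^+ 2 * a6 + 4 * a2 * a6 - a1 * a3 * a4 + a2 * a3 ^+ 2
            - a4 ^+ 2 in
  - b2 ^+ 2 * b8 - 8 * b4 ^+ 3 - 27 * b6 ^+ 2 + 9 * b2 * b4 * b6.

Definition elliptic : Prop := discriminant != 0.

Definition on_curve (P : point K) : Prop :=
  if P is Some (x, y) then
    y ^+ 2 + a1 * x * y + a3 * y = x ^+ 3 + a2 * x ^+ 2 + a4 * x + a6
  else True.

(* The chord-and-tangent group law. *)
Definition ptopp (P : point K) : point K :=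
  if P is Some (x, y) then Some (x, - y - a1 * x - a3) else None.

Definition ptadd (P Q : point K) : point K :=
  match P, Q with
  | None, _ => Q
  | _, None => P
  | Some (x1, y1), Some (x2, y2) =>
    if (x1 == x2) && (y1 + y2 + a1 * x2 + a3 == 0) then None else
    let lam :=
      if x1 == x2 then
        (3 * x1 ^+ 2 + 2 * a2 * x1 + a4 - a1 * y1) / (2 * y1 + a1 * x1 + a3)
      else (y2 - y1) / (x2 - x1) in
    let x3 := lam ^+ 2 + a1 * lam - a2 - x1 - x2 in
    Some (x3, - (lam + a1) * x3 - (y1 - lam * x1) - a3)
  end.

Definition ptsub (P Q : point K) : point K := ptadd P (ptopp Q).

Definition ptmul (n : nat) (P : point K) : point K := iter n (ptadd P) None.

Definition has_order (P : point K) (n : nat) : Prop :=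
  [/\ (0 < n)%N, ptmul n P = None
    & forall m, (0 < m < n)%N -> ptmul m P <> None].

(* The value of the affine coordinates at O is a dummy. *)
Definition xcoord (P : point K) : K := if P is Some (x, _) then x else 0.
Definition ycoord (P : point K) : K := if P is Some (_, y) then y else 0.

(* This has its intended value at P as long as P - A is not one of O and
   +-(A - B); for B = A + t this holds whenever P - A is not a multiple of t. *)
Definition ell_f (A B P : point K) : K :=
  (ycoord (ptsub P A) - ycoord (ptsub A B)) /
  (xcoord (ptsub P A) - xcoord (ptsub A B)).

End Curve.

Definition map_weierstrass (K L : Type) (i : K -> L) (E : weierstrass K) :
    weierstrass L :=
  Weierstrass (i (wa1 E)) (i (wa2 E)) (i (wa3 E)) (i (wa4 E)) (i (wa6 E)).

Definition map_point (K L : Type) (i : K -> L) : point K -> point L :=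
  omap (fun xy => (i xy.1, i xy.2)).

(* The function \sum_(k < n) f_{kt,(k+1)t} on E is the constant c: it takes the
   value c at every point of E outside <t>, over every extension L of K (in
   particular over an algebraic closure, and at the generic point). *)
Definition is_ell_const (K : fieldType) (E : weierstrass K) (n : nat)
    (t : point K) (c : K) : Prop :=
  forall (L : fieldType) (i : {rmorphism K -> L}),
  let E' := map_weierstrass i E in
  let t' := map_point i t in
  forall P : point L, on_curve E' P -> (forall k, P <> ptmul E' k t') ->
    \sum_(k < n) ell_f E' (ptmul E' k t') (ptmul E' k.+1 t') P = i c.

Section Vectors.
Variables (K : fieldType) (n : nat).

Definition weight (v : 'rV[K]_n) : nat := #|[set j | v 0 j != 0]|.

Definition num_zeros (v : 'rV[K]_n) : nat := #|[set j | v 0 j == 0]|.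

(* (v_j v_(j-k))_j with indices modulo n. *)
Definition shift_prod (k : nat) (v : 'rV[K]_n) : 'rV[K]_n :=
  \row_j (v 0 j * v 0 (iter k (@ord_pred n) j)).

Variables (E : weierstrass K) (t R : point K) (a b : K).

Definition vecR : 'rV[K]_n :=
  \row_(j < n) (a * ell_f E None t (ptadd E R (ptmul E j t)) + b).

Definition vecRx : 'rV[K]_n :=
  \row_(j < n) xcoord (ptadd E R (ptmul E j t)).

End Vectors.

(* Main.v *)
(* The points R + jt are affine, pairwise distinct and different from t and -t,
   since n(R + jt) = nR <> O.  At most two of them have abscissa 0.  As
   f_{O,t}(P) is the slope of the line through P and -t, at most two of them
   give a prescribed slope, because that line meets the cubic in -t and two
   further points.
   The group law comes from the class group of the coordinate ring
   F[X, Y]/(W): the ideals of P and Q multiply to the class of the ideal of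
   P + Q, and P is determined by the class of its ideal, because an element
   p(X) + q(X)Y with q <> 0 has norm of degree at least 3. *)
From HB Require Import structures.
Require Import Defs.
From mathcomp Require Import all_boot all_order all_algebra all_field.
From mathcomp Require Import ring zify.

Set Implicit Arguments.
Unset Strict Implicit.
Unset Printing Implicit Defensive.

Import Order.TTheory GRing.Theory Num.Theory.
Local Open Scope ring_scope.

(** * Classes of finitely generated ideals *)

Section Ideals.
Variable A : comNzRingType.
Implicit Types (s t u : seq A) (x y f g : A).

(** Coefficients are peeled off one generator at a time, so that membership in an explicit ideal is
    shown by listing coefficients and checking one ring identity. *)
Fixpoint in_ideal s x : Prop :=
  if s is g :: s' then exists k, in_ideal s' (x - k * g) else x = 0.

Lemma in_ideal0 s : in_ideal s 0.
Proof. by elim: s => //= g s IHs; exists 0; rewrite mul0r subr0. Qed.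

Lemma in_idealD s x y : in_ideal s x -> in_ideal s y -> in_ideal s (x + y).
Proof.
elim: s x y => [|g s IHs] x y /=; first by move=> -> ->; rewrite addr0.
move=> [k Hk] [l Hl]; exists (k + l).
by have := IHs _ _ Hk Hl; congr in_ideal; ring.
Qed.

Lemma in_idealMl s k x : in_ideal s x -> in_ideal s (k * x).
Proof.
elim: s x => [|g s IHs] x /=; first by move=> ->; rewrite mulr0.
by move=> [l Hl]; exists (k * l); have := IHs _ Hl; congr in_ideal; ring.
Qed.

Lemma in_ideal_mem s x : x \in s -> in_ideal s x.
Proof.
elim: s => //= g s IHs; rewrite inE => /predU1P[->|/IHs Hx].
  by exists 1; rewrite mul1r subrr; apply: in_ideal0.
by exists 0; rewrite mul0r subr0.
Qed.

Lemma in_ideal_ind (P : A -> Prop) s :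
  P 0 -> (forall x y, P x -> P y -> P (x + y)) ->
  (forall k x, P x -> P (k * x)) -> (forall x, x \in s -> P x) ->
  forall x, in_ideal s x -> P x.
Proof.
move=> P0 PD PM; elim: s => [|g s IHs] Ps x /=; first by move->.
move=> [k Hk]; rewrite -(subrK (k * g) x); apply: PD.
  by apply: IHs Hk => y ys; apply: Ps; rewrite inE ys orbT.
by apply: PM; apply: Ps; rewrite mem_head.
Qed.

Definition ideal_le s t := forall x, x \in s -> in_ideal t x.

Lemma ideal_leP s t x : ideal_le s t -> in_ideal s x -> in_ideal t x.
Proof.
move=> st; apply: in_ideal_ind => //; first exact: in_ideal0.
  exact: in_idealD.
exact: in_idealMl.
Qed.

Lemma ideal_le_refl s : ideal_le s s.
Proof. by move=> x; apply: in_ideal_mem. Qed.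

Lemma ideal_le_trans t s u : ideal_le s t -> ideal_le t u -> ideal_le s u.
Proof. by move=> st tu x /st; apply: ideal_leP. Qed.

Definition idealZ f s := [seq f * x | x <- s].

Definition idealM s t := [seq x * y | x <- s, y <- t].

Lemma in_idealZ f s x : in_ideal (idealZ f s) x <-> exists2 y, in_ideal s y & x = f * y.
Proof.
split; last first.
  case=> y ys ->; move: y ys; apply: in_ideal_ind.
  - by rewrite mulr0; apply: in_ideal0.
  - by move=> y z Hy Hz; rewrite mulrDr; apply: in_idealD.
  - by move=> k y Hy; rewrite mulrCA; apply: in_idealMl.
  - by move=> y ys; apply: in_ideal_mem; apply: map_f.
move: x; apply: in_ideal_ind.
- by exists 0; [apply: in_ideal0 | rewrite mulr0].
- move=> _ _ [y ys ->] [z zs ->]; exists (y + z); last by rewrite mulrDr.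
  exact: in_idealD.
- by move=> k _ [y ys ->]; exists (k * y); [apply: in_idealMl | ring].
- by move=> _ /mapP[y ys ->]; exists y; [apply: in_ideal_mem |].
Qed.

Lemma in_idealM s t x y :
  in_ideal s x -> in_ideal t y -> in_ideal (idealM s t) (x * y).
Proof.
move=> + yt; move: x; apply: in_ideal_ind.
- by rewrite mul0r; apply: in_ideal0.
- by move=> x z Hx Hz; rewrite mulrDl; apply: in_idealD.
- by move=> k x Hx; rewrite -mulrA; apply: in_idealMl.
move=> x xs; move: y yt; apply: in_ideal_ind.
- by rewrite mulr0; apply: in_ideal0.
- by move=> y z Hy Hz; rewrite mulrDr; apply: in_idealD.
- by move=> k y Hy; rewrite mulrCA; apply: in_idealMl.
by move=> y yt; apply: in_ideal_mem; apply: allpairs_f.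
Qed.

Lemma idealM_le s s' t t' :
  ideal_le s s' -> ideal_le t t' -> ideal_le (idealM s t) (idealM s' t').
Proof. by move=> ss tt _ /allpairsP[[x y] /= [/ss ? /tt ? ->]]; apply: in_idealM. Qed.

Lemma idealZ_le f s t : ideal_le s t -> ideal_le (idealZ f s) (idealZ f t).
Proof. by move=> st _ /mapP[x /st xt ->]; apply/in_idealZ; exists x. Qed.

Lemma idealMC_le s t : ideal_le (idealM s t) (idealM t s).
Proof.
by move=> _ /allpairsP[[x y] /= [xs yt ->]]; rewrite mulrC; apply/in_ideal_mem/allpairs_f.
Qed.

Lemma idealMA_le s t u : ideal_le (idealM s (idealM t u)) (idealM (idealM s t) u).
Proof.
move=> _ /allpairsP[[x _] /= [xs /allpairsP[[y z] /= [yt zu ->]] ->]].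
by rewrite mulrA; apply/in_ideal_mem/allpairs_f => //; apply: allpairs_f.
Qed.

Lemma idealZM f g s : idealZ f (idealZ g s) = idealZ (f * g) s.
Proof. by rewrite /idealZ -map_comp; apply: eq_map => x /=; rewrite mulrA. Qed.

Lemma idealMZl_le f s t : ideal_le (idealM (idealZ f s) t) (idealZ f (idealM s t)).
Proof.
move=> _ /allpairsP[[_ y] /= [/mapP[x xs ->] yt ->]]; rewrite -mulrA.
by apply/in_ideal_mem/map_f/allpairs_f.
Qed.

Lemma idealZMl_le f s t : ideal_le (idealZ f (idealM s t)) (idealM (idealZ f s) t).
Proof.
move=> _ /mapP[_ /allpairsP[[x y] /= [xs yt ->]] ->]; rewrite mulrA.
by apply/in_ideal_mem/allpairs_f => //; apply: map_f.
Qed.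

(** Equality of ideal classes without fractions. Regular multipliers take the place of nonzero ones
    because [A] is not assumed to be a domain. *)
Definition ideal_equiv s t := exists f g,
  [/\ GRing.lreg f, GRing.lreg g, ideal_le (idealZ f s) (idealZ g t)
    & ideal_le (idealZ g t) (idealZ f s)].

Lemma ideal_equiv_le s t : ideal_le s t -> ideal_le t s -> ideal_equiv s t.
Proof. by move=> st ts; exists 1, 1; split; try exact: lreg1; apply: idealZ_le. Qed.

Lemma ideal_equiv_refl s : ideal_equiv s s.
Proof. by apply: ideal_equiv_le; apply: ideal_le_refl. Qed.

Lemma ideal_equiv_sym s t : ideal_equiv s t -> ideal_equiv t s.
Proof. by case=> f [g [? ? ? ?]]; exists g, f. Qed.

Lemma ideal_equiv_trans t s u :
  ideal_equiv s t -> ideal_equiv t u -> ideal_equiv s u.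
Proof.
move=> [f [g [f_reg g_reg st ts]]] [f' [g' [f'_reg g'_reg tu ut]]].
(* Cross-multiplication: [f' f s = f' g t = g f' t = g g' u]. *)
exists (f' * f), (g * g'); split; try exact: lregM; rewrite -!idealZM.
  apply: ideal_le_trans (idealZ_le st) _; rewrite idealZM mulrC -idealZM.
  exact: idealZ_le.
apply: ideal_le_trans (idealZ_le ut) _; rewrite idealZM mulrC -idealZM.
exact: idealZ_le.
Qed.

Lemma ideal_equivMl s t u : ideal_equiv s t -> ideal_equiv (idealM s u) (idealM t u).
Proof.
move=> [f [g [f_reg g_reg st ts]]]; exists f, g; split => //.
  apply: ideal_le_trans (@idealZMl_le _ _ _) _.
  apply: ideal_le_trans (@idealMZl_le _ _ _).
  by apply: idealM_le => //; apply: ideal_le_refl.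
apply: ideal_le_trans (@idealZMl_le _ _ _) _.
apply: ideal_le_trans (@idealMZl_le _ _ _).
by apply: idealM_le => //; apply: ideal_le_refl.
Qed.

Lemma ideal_equivMC s t : ideal_equiv (idealM s t) (idealM t s).
Proof. by apply: ideal_equiv_le; apply: idealMC_le. Qed.

Lemma ideal_equivMr s t u : ideal_equiv s t -> ideal_equiv (idealM u s) (idealM u t).
Proof.
move=> st; apply: ideal_equiv_trans (ideal_equivMC t u).
by apply: ideal_equiv_trans (ideal_equivMC u s) _; apply: ideal_equivMl.
Qed.

Lemma ideal_equivMA s t u :
  ideal_equiv (idealM s (idealM t u)) (idealM (idealM s t) u).
Proof.
apply: ideal_equiv_le; first exact: idealMA_le.
apply: ideal_le_trans (@idealMC_le _ _) _.
apply: ideal_le_trans (@idealMC_le _ _).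
apply: (@ideal_le_trans (idealM u (idealM t s))).
  by apply: idealM_le; [apply: ideal_le_refl | apply: idealMC_le].
apply: ideal_le_trans (@idealMA_le _ _ _) _.
by apply: idealM_le; [apply: idealMC_le | apply: ideal_le_refl].
Qed.

(** If [f s] is the ideal of [g], then [g = f h] with [h] in the ideal of [s], and cancelling the
    regular [f] shows that [h] generates it. *)
Lemma ideal_equiv_principal s : ideal_equiv s [:: 1] ->
  exists2 h, in_ideal s h & forall x, in_ideal s x -> exists k, x = h * k.
Proof.
case=> f [g [f_reg _ sg gs]].
have /in_idealZ[h hs Eg] : in_ideal (idealZ f s) g.
  by apply: gs; rewrite /= mulr1 mem_head.
exists h => // x xs.
have /(ideal_leP sg)[k /= /subr0_eq Ek] : in_ideal (idealZ f s) (f * x).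
  by apply/in_idealZ; exists x.
by exists k; apply: f_reg; rewrite Ek mulr1 Eg; ring.
Qed.

End Ideals.

(** * Ideals of points *)

Section PointIdeals.
Variables (F : fieldType) (E : weierstrass F) (A : comNzRingType).
Variables (i : {rmorphism F -> A}) (X Y : A).
Local Notation a1 := (wa1 E).
Local Notation a2 := (wa2 E).
Local Notation a3 := (wa3 E).
Local Notation a4 := (wa4 E).
Local Notation a6 := (wa6 E).

Hypothesis XY_curve :
  Y ^+ 2 + i a1 * X * Y + i a3 * Y = X ^+ 3 + i a2 * X ^+ 2 + i a4 * X + i a6.
Hypothesis vert_reg : forall x, GRing.lreg (X - i x).
Hypothesis line_reg : forall l m, GRing.lreg (Y - i l * X - i m).

(** In the coordinate ring these are the functions vanishing at [P]. The identity O gets the unit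
    ideal, which is neutral for the product. *)
Definition pt_ideal (P : point F) : seq A :=
  if P is Some (x, y) then [:: X - i x; Y - i y] else [:: 1].

(** If both partial derivatives vanish, they and the curve equation express [a3], [a4], [a6] by the
    remaining data; after substitution the discriminant is identically zero. *)
Lemma elliptic_nonsingular x y : elliptic E -> on_curve E (Some (x, y)) ->
  (3 * x ^+ 2 + 2 * a2 * x + a4 - a1 * y != 0) || (2 * y + a1 * x + a3 != 0).
Proof.
move=> E_ell /= Exy; rewrite -negb_and; apply/negP => /andP[/eqP EX /eqP EY].
case/negP: E_ell; rewrite /discriminant.
have Ea3 : a3 = - 2 * y - a1 * x.
  by apply: subr0_eq; rewrite -[RHS]EY; ring.
have Ea4 : a4 = a1 * y - 3 * x ^+ 2 - 2 * a2 * x.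
  by apply: subr0_eq; rewrite -[RHS]EX; ring.
have Ea6 : a6 = y ^+ 2 + a1 * x * y + a3 * y - x ^+ 3 - a2 * x ^+ 2 - a4 * x.
  by rewrite Exy; ring.
by rewrite Ea6 Ea4 Ea3; apply/eqP; ring.
Qed.

(** The product is the ideal of the vertical line [X - i x]. That line divides all products of
    generators; conversely, a combination of the two partial derivatives equal to 1 recovers it. *)
Lemma pt_ideal_opp P : elliptic E -> on_curve E P ->
  ideal_equiv (idealM (pt_ideal P) (pt_ideal (ptopp E P))) [:: 1].
Proof.
move=> E_ell; case: P => [[x y]|] Pxy /=; last first.
  by apply: ideal_equiv_le => z; rewrite /= inE mulr1 => /eqP->;
     exists 1; rewrite mulr1 subrr.
have [al [be abE]] : exists al be,
    al * (3 * x ^+ 2 + 2 * a2 * x + a4 - a1 * y) + be * (2 * y + a1 * x + a3) = 1.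
  have [u0|v0] := orP (elliptic_nonsingular E_ell Pxy).
    by exists (3 * x ^+ 2 + 2 * a2 * x + a4 - a1 * y)^-1, 0; rewrite mul0r addr0 mulVf.
  by exists 0, (2 * y + a1 * x + a3)^-1; rewrite mul0r add0r mulVf.
have /= := Pxy; set w := LHS; set w' := RHS => Ew.
have {}Ew : i w - i w' = 0 by rewrite Ew subrr.
move/eqP: XY_curve; rewrite -subr_eq0; set W := (X in X == _) => /eqP EW.
have {}abE : 1 - i (al * (3 * x ^+ 2 + 2 * a2 * x + a4 - a1 * y)
    + be * (2 * y + a1 * x + a3)) = 0 by rewrite abE rmorph1 subrr.
exists 1, (X - i x); split; [exact: lreg1 | exact: vert_reg | |].
  move=> z; rewrite /= !mul1r mulr1 !inE => /or4P[] /eqP->.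
  - by exists (X - i x); ring.
  - by exists (Y - i (- y - a1 * x - a3)); ring.
  - by exists (Y - i y); ring.
  (* The quotient of the product of [Y - i y] and its opposite counterpart by [X - i x], modulo the
     curve equation. *)
  exists (X ^+ 2 + X * i x + i x ^+ 2 + i a2 * (X + i x) + i a4 - i a1 * Y).
  rewrite -[RHS]EW -[RHS]subr0 -[in RHS]Ew /W /w /w'; ring.
move=> z; rewrite /= !mul1r mulr1 inE => /eqP->.
(* After division by [X - i x], the terms in [be] add up to [be * (2 * y + a1 * x + a3)] and those
   in [al] to [al * (3 * x ^+ 2 + 2 * a2 * x + a4 - a1 * y)]. *)
exists (- i al * (X + 2 * i x + i a2)), (i be), (i al * i a1 - i be), (i al).
transitivity ((X - i x) * (1 - i (al * (3 * x ^+ 2 + 2 * a2 * x + a4 - a1 * y)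
    + be * (2 * y + a1 * x + a3))) - i al * (W - (i w - i w'))).
  by rewrite /W /w /w'; ring.
by rewrite EW Ew abE; ring.
Qed.

(* The line [y = l x + m] meets the curve in [P], [Q] and a third point of
   abscissa [x3]: the three middle equations compare the coefficients of a cubic
   in [x].  The last condition excludes [Q = - P]. *)
Definition chord (x1 y1 x2 y2 l m x3 : F) : Prop :=
  [/\ y1 = l * x1 + m, y2 = l * x2 + m,
      [/\ x1 + x2 + x3 = l ^+ 2 + a1 * l - a2,
      x1 * x2 + x1 * x3 + x2 * x3 = a4 - 2 * l * m - a1 * m - a3 * l
    & x1 * x2 * x3 = m ^+ 2 + a3 * m - a6]
    & (x1 != x2) || ((x1 == x2) && (2 * y1 + a1 * x1 + a3 != 0))].

(** Replaces the division formulas of the group law by Vieta relations, which treat chord and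
    tangent alike. *)
Lemma ptadd_chord x1 y1 x2 y2 :
  on_curve E (Some (x1, y1)) -> on_curve E (Some (x2, y2)) ->
  (ptadd E (Some (x1, y1)) (Some (x2, y2)) = None /\
     Some (x2, y2) = ptopp E (Some (x1, y1))) \/
  exists l m x3, chord x1 y1 x2 y2 l m x3 /\
    ptadd E (Some (x1, y1)) (Some (x2, y2)) = Some (x3, - (l + a1) * x3 - m - a3).
Proof.
move=> /= E1 E2; case: ifP => [/andP[/eqP-> /eqP Ey]|nopp].
  by left; split=> //; congr (Some (_, _)); rewrite -[LHS](subr0) -Ey; ring.
right; case: (eqVneq x1 x2) nopp => [Ex /= yy0|nx _].
  subst x2.
  (* The difference of the two curve equations factors, and the second factor is nonzero as the
     points are not opposite. *)
  have y12 : y1 = y2.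
    have : (y1 - y2) * (y1 + y2 + a1 * x1 + a3) == 0.
      by apply/eqP; transitivity ((y1 ^+ 2 + a1 * x1 * y1 + a3 * y1) -
        (y2 ^+ 2 + a1 * x1 * y2 + a3 * y2)); [ring | rewrite E1 E2 subrr].
    by rewrite mulf_eq0 yy0 orbF subr_eq0 => /eqP.
  subst y2; have d0 : 2 * y1 + a1 * x1 + a3 != 0 by rewrite mulr2n mulrDl mul1r yy0.
  set l := _ / _; exists l, (y1 - l * x1); eexists; split; last by [].
  have El : l * (2 * y1 + a1 * x1 + a3) = 3 * x1 ^+ 2 + 2 * a2 * x1 + a4 - a1 * y1.
    by rewrite divfK.
  split; try ring; last by rewrite eqxx d0 orbT.
  split; first by ring.
  - apply: subr0_eq.
    transitivity (l * (2 * y1 + a1 * x1 + a3) -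
       (3 * x1 ^+ 2 + 2 * a2 * x1 + a4 - a1 * y1)); first ring.
    by rewrite El subrr.
  apply: subr0_eq.
  transitivity (x1 * (l * (2 * y1 + a1 * x1 + a3) -
       (3 * x1 ^+ 2 + 2 * a2 * x1 + a4 - a1 * y1)) -
     (y1 ^+ 2 + a1 * x1 * y1 + a3 * y1 - (x1 ^+ 3 + a2 * x1 ^+ 2 + a4 * x1 + a6)));
     first ring.
  by rewrite El E1 !subrr; ring.
set l := _ / _; exists l, (y1 - l * x1); eexists; split; last by [].
have x21 : x2 - x1 != 0 by rewrite subr_eq0 eq_sym.
have El : y2 = l * x2 + (y1 - l * x1).
  by transitivity (l * (x2 - x1) + y1); [rewrite divfK //|]; ring.
set x3 := l ^+ 2 + a1 * l - a2 - x1 - x2; set m := y1 - l * x1.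
have Em : y1 = l * x1 + m by rewrite /m; ring.
rewrite -/m in El.
(* The cubic cut out by the line, minus the monic cubic with roots [x1], [x2], [x3], is the linear
   polynomial with coefficients [e2] and [e3]: the choice of [x3] kills the quadratic term. Two
   distinct roots [x1], [x2] force it to be zero. *)
set e2 := a4 - 2 * l * m - a1 * m - a3 * l - (x1 * x2 + x1 * x3 + x2 * x3).
set e3 := a6 - m ^+ 2 - a3 * m + x1 * x2 * x3.
have R1 : e2 * x1 + e3 = 0.
  transitivity (x1 ^+ 3 + a2 * x1 ^+ 2 + a4 * x1 + a6 -
    (y1 ^+ 2 + a1 * x1 * y1 + a3 * y1)); last by rewrite E1 subrr.
  by rewrite Em /e2 /e3 /x3; ring.
have R2 : e2 * x2 + e3 = 0.
  transitivity (x2 ^+ 3 + a2 * x2 ^+ 2 + a4 * x2 + a6 -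
    (y2 ^+ 2 + a1 * x2 * y2 + a3 * y2)); last by rewrite E2 subrr.
  by rewrite El /e2 /e3 /x3; ring.
have e20 : e2 = 0.
  apply: (mulIf x21); rewrite mul0r.
  by transitivity (e2 * x2 + e3 - (e2 * x1 + e3)); [ring | rewrite R1 R2 subrr].
have e30 : e3 = 0 by rewrite -R1 e20; ring.
split => //; last by rewrite nx.
split; first by rewrite /x3; ring.
  by apply/esym/subr0_eq; rewrite -/e2.
by apply: subr0_eq; rewrite -[RHS]e30 /e3; ring.
Qed.

Lemma on_curve_chord x1 y1 x2 y2 l m x3 : chord x1 y1 x2 y2 l m x3 ->
  on_curve E (Some (x3, - (l + a1) * x3 - m - a3)).
Proof.
move=> [_ _ [e1 e2 e3] _] /=; apply: subr0_eq.
(* The Vieta relations weighted by powers of [x3] express that [x3] is a root of the cubic on the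
   line. *)
transitivity (x3 * (x1 * x2 + x1 * x3 + x2 * x3 - (a4 - 2 * l * m - a1 * m - a3 * l))
  - x3 ^+ 2 * (x1 + x2 + x3 - (l ^+ 2 + a1 * l - a2))
  - (x1 * x2 * x3 - (m ^+ 2 + a3 * m - a6))); first ring.
by rewrite e1 e2 e3; ring.
Qed.

(** With [L] the line and [L'] its conjugate, up to sign, [L * L'] is the product of the three
    vertical lines. Hence [X - i x3] times the product of the two ideals equals [L] times the ideal
    of the sum; the core is that [L] lies in that product of ideals. *)
Lemma pt_ideal_chord x1 y1 x2 y2 l m x3 : chord x1 y1 x2 y2 l m x3 ->
  ideal_equiv (idealM (pt_ideal (Some (x1, y1))) (pt_ideal (Some (x2, y2))))
    (pt_ideal (Some (x3, - (l + a1) * x3 - m - a3))).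
Proof.
move=> [Ey1 Ey2 [e1 e2 e3] nd].
pose L := Y - i l * X - i m.
pose L' := Y + i a1 * X + i a3 + i l * X + i m.
have ELL : L * L' = (X - i x1) * (X - i x2) * (X - i x3).
  apply: subr0_eq.
  transitivity ((Y ^+ 2 + i a1 * X * Y + i a3 * Y -
      (X ^+ 3 + i a2 * X ^+ 2 + i a4 * X + i a6))
    + X ^+ 2 * i (x1 + x2 + x3 - (l ^+ 2 + a1 * l - a2))
    - X * i (x1 * x2 + x1 * x3 + x2 * x3 - (a4 - 2 * l * m - a1 * m - a3 * l))
    + i (x1 * x2 * x3 - (m ^+ 2 + a3 * m - a6))).
    by rewrite /L /L'; ring.
  by rewrite XY_curve e1 e2 e3 !subrr !rmorph0; ring.
have EL' : L' = Y - i (- (l + a1) * x3 - m - a3) + i (l + a1) * (X - i x3).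
  by rewrite /L'; ring.
have EY1 : Y - i y1 = L + i l * (X - i x1) by rewrite /L Ey1; ring.
have EY2 : Y - i y2 = L + i l * (X - i x2) by rewrite /L Ey2; ring.
set J := idealM _ _.
have in_J u v : in_ideal (pt_ideal (Some (x1, y1))) u ->
    in_ideal (pt_ideal (Some (x2, y2))) v -> in_ideal J (u * v).
  exact: in_idealM.
have L1 : in_ideal (pt_ideal (Some (x1, y1))) L.
  by exists (- i l), 1; rewrite EY1; ring.
have L2 : in_ideal (pt_ideal (Some (x2, y2))) L.
  by exists (- i l), 1; rewrite EY2; ring.
have X1 : in_ideal (pt_ideal (Some (x1, y1))) (X - i x1).
  by apply/in_ideal_mem/mem_head.
have X2 : in_ideal (pt_ideal (Some (x2, y2))) (X - i x2).
  by apply/in_ideal_mem/mem_head.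
have LJ : in_ideal J L.
  case/orP: nd => [nx|/andP[/eqP Ex d0]].
    (* For a chord, the difference of [(X - i x1) * L] and [L * (X - i x2)] is [L] times the unit
       [i (x2 - x1)]. *)
    have -> : L = i (x2 - x1)^-1 * ((X - i x1) * L + (-1) * (L * (X - i x2))).
      have : i (x2 - x1)^-1 * i (x2 - x1) = 1.
        by rewrite -rmorphM mulVf ?rmorph1 // subr_eq0 eq_sym.
      by move: (i _^-1) => e Ei; rewrite -[LHS]mul1r -[X in X * _]Ei; ring.
    by apply/in_idealMl/in_idealD; [| apply: in_idealMl]; apply: in_J.
  (* For a tangent, [L' - L - i (2 * l + a1) * (X - i x1)] is the constant [i d]; multiplying by [L]
     and using [ELL] leaves only elements of [J]. *)
  subst x2; set d := 2 * y1 + a1 * x1 + a3 in d0.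
  have -> : L = i d^-1 * (((X - i x1) * (X - i x1)) * (X - i x3) +
      (-1) * (L * L) + (- i (2 * l + a1)) * ((X - i x1) * L)).
    rewrite -ELL; have : i d^-1 * i d = 1 by rewrite -rmorphM mulVf ?rmorph1.
    move: (i d^-1) => e Ei; rewrite -[LHS]mul1r -[X in X * _]Ei.
    by rewrite /L' /L /d Ey1; ring.
  apply/in_idealMl; rewrite [X in X + _ + _]mulrC.
  by apply: in_idealD; first apply: in_idealD; apply: in_idealMl; apply: in_J.
exists (X - i x3), L; split; [exact: vert_reg | exact: line_reg | |].
  have XX : in_ideal (idealZ L (pt_ideal (Some (x3, - (l + a1) * x3 - m - a3))))
      ((X - i x3) * ((X - i x1) * (X - i x2))).
    apply/in_idealZ; exists L'; last by rewrite ELL; ring.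
    by exists (i (l + a1)), 1; rewrite EL'; ring.
  have XL : in_ideal (idealZ L (pt_ideal (Some (x3, - (l + a1) * x3 - m - a3))))
      ((X - i x3) * L).
    apply/in_idealZ; exists (X - i x3); last by rewrite mulrC.
    exact/in_ideal_mem/mem_head.
  (* Each ordinate generator is [L] plus a multiple of a vertical line, so all four products are
     combinations of [XX] and [XL]. *)
  move: (idealZ L _) XX XL => I XX XL z /mapP[_ /allpairsP[[u v] /= [+ + ->]] ->].
  rewrite !inE => /orP[] /eqP-> /orP[] /eqP-> //; rewrite ?EY1 ?EY2.
  - have -> : (X - i x3) * ((X - i x1) * (L + i l * (X - i x2))) =
      (X - i x1) * ((X - i x3) * L) + i l * ((X - i x3) * ((X - i x1) * (X - i x2))).
      by ring.
    by apply: in_idealD; apply: in_idealMl.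
  - have -> : (X - i x3) * ((L + i l * (X - i x1)) * (X - i x2)) =
      (X - i x2) * ((X - i x3) * L) + i l * ((X - i x3) * ((X - i x1) * (X - i x2))).
      by ring.
    by apply: in_idealD; apply: in_idealMl.
  have -> : (X - i x3) * ((L + i l * (X - i x1)) * (L + i l * (X - i x2))) =
    (L + i l * (X - i x1) + i l * (X - i x2)) * ((X - i x3) * L) +
      i l ^+ 2 * ((X - i x3) * ((X - i x1) * (X - i x2))).
    by ring.
  by apply: in_idealD; apply: in_idealMl.
have XL : in_ideal (idealZ (X - i x3) J) ((X - i x3) * L).
  by apply/in_idealZ; exists L.
move=> z /mapP[u + ->]; rewrite !inE => /orP[] /eqP->; first by rewrite mulrC.
have -> : L * (Y - i (- (l + a1) * x3 - m - a3)) =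
    L * L' + (- i (l + a1)) * ((X - i x3) * L) by rewrite EL'; ring.
apply: in_idealD; last exact: in_idealMl.
rewrite ELL mulrC; apply/in_idealZ; exists ((X - i x1) * (X - i x2)) => //.
exact: in_J.
Qed.

Lemma on_curve_opp P : on_curve E P -> on_curve E (ptopp E P).
Proof. by case: P => [[x y]|] //= <-; ring. Qed.

Lemma on_curve_add P Q : on_curve E P -> on_curve E Q -> on_curve E (ptadd E P Q).
Proof.
case: P Q => [[x1 y1]|] [[x2 y2]|] // P_on Q_on.
have [[-> _] //|[l [m [x3 [ch ->]]]]] := ptadd_chord P_on Q_on.
exact: on_curve_chord ch.
Qed.

(** Passing to ideal classes is thus multiplicative, so the group laws can be read off from products
    of ideals. *)
Lemma pt_ideal_add P Q : elliptic E -> on_curve E P -> on_curve E Q ->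
  ideal_equiv (idealM (pt_ideal P) (pt_ideal Q)) (pt_ideal (ptadd E P Q)).
Proof.
move=> E_ell; have mul1 s : ideal_equiv (idealM [:: 1] s) s.
  suff -> : idealM [:: 1] s = s by apply: ideal_equiv_refl.
  by rewrite /idealM /= cats0 -[RHS]map_id; apply: eq_map => x; rewrite mul1r.
case: P => [[x1 y1]|] P_on; last by move=> _; apply: mul1.
case: Q => [[x2 y2]|] Q_on.
  have [[-> ->] //|[l [m [x3 [ch ->]]]]] := ptadd_chord P_on Q_on.
    exact: pt_ideal_opp.
  exact: pt_ideal_chord ch.
by apply: ideal_equiv_trans (ideal_equivMC _ _) _; apply: mul1.
Qed.

End PointIdeals.

(** * The coordinate ring *)

(* [R[Y] / (Y^2 + b Y - c)] on the basis [(1, Y)]. *)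
Definition quad_ext (R : comNzRingType) (b c : R) : Type := (R * R)%type.

Section QuadExt.
Variables (R : comNzRingType) (b c : R).
Local Notation A := (quad_ext b c).

HB.instance Definition _ := GRing.Zmodule.copy A (R * R)%type.

Definition quad_one : A := (1, 0).
Definition quad_mul (u v : A) : A :=
  (u.1 * v.1 + u.2 * v.2 * c, u.1 * v.2 + u.2 * v.1 - u.2 * v.2 * b).

Fact quad_mulA : associative quad_mul.
Proof. by move=> u v w; congr (_, _) => /=; ring. Qed.
Fact quad_mulC : commutative quad_mul.
Proof. by move=> u v; congr (_, _) => /=; ring. Qed.
Fact quad_mul1 : left_id quad_one quad_mul.
Proof. by move=> [u v]; congr (_, _) => /=; ring. Qed.
Fact quad_mulDl : left_distributive quad_mul +%R.
Proof. by move=> u v w; congr (_, _) => /=; ring. Qed.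
Fact quad_one_neq0 : quad_one != 0.
Proof. by apply/eqP => -[/eqP]; rewrite oner_eq0. Qed.

HB.instance Definition _ := GRing.Zmodule_isComNzRing.Build A
  quad_mulA quad_mulC quad_mul1 quad_mulDl quad_one_neq0.

Lemma quad_mulE (u v : A) : u * v =
  (u.1 * v.1 + u.2 * v.2 * c, u.1 * v.2 + u.2 * v.1 - u.2 * v.2 * b) :> A.
Proof. by []. Qed.

Definition quad_of (r : R) : A := (r, 0).

Fact quad_of_zmod : zmod_morphism quad_of.
Proof. by move=> r s; congr (_, _); rewrite subr0. Qed.
Fact quad_of_monoid : monoid_morphism quad_of.
Proof. by split=> // r s; rewrite quad_mulE /=; congr (_, _); ring. Qed.

HB.instance Definition _ := GRing.isZmodMorphism.Build R A quad_of quad_of_zmod.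
HB.instance Definition _ := GRing.isMonoidMorphism.Build R A quad_of quad_of_monoid.

Definition quad_gen : A := (0, 1).

Lemma quad_genE : quad_gen ^+ 2 + quad_of b * quad_gen = quad_of c.
Proof. by rewrite expr2 !quad_mulE; congr (_, _) => /=; ring. Qed.

(** The product of [u] with its conjugate under [Y] to [- b - Y]. *)
Definition quad_norm (u : A) : R := u.1 ^+ 2 - b * u.1 * u.2 - c * u.2 ^+ 2.

Lemma quad_normM u v : quad_norm (u * v) = quad_norm u * quad_norm v.
Proof. by rewrite quad_mulE /quad_norm /=; ring. Qed.

(** Multiplying [u * (v - w) = 0] by the conjugate of [u] gives [quad_norm u * (v - w) = 0]; the two
    combinations below are its components. *)
Lemma quad_norm_lreg u : GRing.lreg (quad_norm u) -> GRing.lreg u.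
Proof.
move=> u_reg v w; rewrite !quad_mulE => -[E1 E2].
have reg0 z : quad_norm u * z = 0 -> z = 0.
  by move=> Ez; apply: u_reg; rewrite mulr0.
have {}E1 : u.1 * (v.1 - w.1) + u.2 * (v.2 - w.2) * c = 0.
  by move/eqP: E1; rewrite -subr_eq0 => /eqP <-; ring.
have {}E2 : u.1 * (v.2 - w.2) + u.2 * (v.1 - w.1) - u.2 * (v.2 - w.2) * b = 0.
  by move/eqP: E2; rewrite -subr_eq0 => /eqP <-; ring.
case: v w E1 E2 => [v1 v2] [w1 w2] /= E1 E2.
congr (_, _); apply/subr0_eq/reg0.
  transitivity ((u.1 - b * u.2) * (u.1 * (v1 - w1) + u.2 * (v2 - w2) * c)
    - c * u.2 * (u.1 * (v2 - w2) + u.2 * (v1 - w1) - u.2 * (v2 - w2) * b)).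
    by rewrite /quad_norm; ring.
  by rewrite E1 E2; ring.
transitivity (u.1 * (u.1 * (v2 - w2) + u.2 * (v1 - w1) - u.2 * (v2 - w2) * b)
  - u.2 * (u.1 * (v1 - w1) + u.2 * (v2 - w2) * c)).
  by rewrite /quad_norm; ring.
by rewrite E1 E2; ring.
Qed.

End QuadExt.

(** * Norms in the coordinate ring of the curve, and the group laws *)

Section Jacobian.
Variables (F : fieldType) (E : weierstrass F).
Local Notation a1 := (wa1 E).
Local Notation a2 := (wa2 E).
Local Notation a3 := (wa3 E).
Local Notation a4 := (wa4 E).
Local Notation a6 := (wa6 E).

Definition ws_b : {poly F} := a1%:P * 'X + a3%:P.
Definition ws_c : {poly F} := 'X ^+ 3 + a2%:P * 'X ^+ 2 + a4%:P * 'X + a6%:P.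
Local Notation A := (quad_ext ws_b ws_c).
Local Notation i := (@quad_of _ ws_b ws_c \o polyC).
Local Notation X := (@quad_of _ ws_b ws_c 'X).
Local Notation Y := (@quad_gen _ ws_b ws_c).

Lemma coord_curve :
  Y ^+ 2 + i a1 * X * Y + i a3 * Y = X ^+ 3 + i a2 * X ^+ 2 + i a4 * X + i a6.
Proof.
transitivity (Y ^+ 2 + quad_of ws_b ws_c ws_b * Y).
  by rewrite [in X in _ = _ + X * _]/ws_b /=; ring.
by rewrite quad_genE [in LHS]/ws_c /=; ring.
Qed.

Lemma size_ws_b : (size ws_b <= 2)%N.
Proof. by apply/leq_sizeP => [[|[|j]]] // _; rewrite !coefE /= mulr0 addr0. Qed.

Lemma size_ws_c : size ws_c = 4%N.
Proof.
rewrite /ws_c -!addrA size_polyDl size_polyXn // ltnS.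
by apply/leq_sizeP => [[|[|[|j]]]] // _; rewrite !coefE /= !mulr0 !addr0.
Qed.

(** The term [ws_c * v ^+ 2] has odd degree at least 3 and [u ^+ 2] has even degree, so they cannot
    cancel; the mixed term has degree below the larger of the two. *)
Lemma size_norm_form (u v : {poly F}) : v != 0 ->
  (3 < size (u ^+ 2 - ws_b * u * v - ws_c * v ^+ 2)%R)%N.
Proof.
move=> v0; have v_gt0 : (0 < size v)%N by rewrite size_poly_gt0.
have sizeM (r s : {poly F}) : r != 0 -> s != 0 -> size (r * s) = (size r + size s).-1.
  exact: size_mul.
have sizeD (r s : {poly F}) : (size (r + s)%R <= maxn (size r) (size s))%N.
  exact: size_polyD.
have sizeB (r s : {poly F}) : (size (r - s)%R <= maxn (size r) (size s))%N.
  by rewrite -(size_polyN s) sizeD.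
have Scv : size (ws_c * v ^+ 2) = (2 * size v + 2)%N.
  rewrite sizeM ?expf_neq0 -?size_poly_gt0 ?size_ws_c // expr2 sizeM //.
  lia.
have [->|u0] := eqVneq u 0.
  by rewrite expr2 !(mul0r, mulr0) subr0 sub0r size_polyN Scv; lia.
have u_gt0 : (0 < size u)%N by rewrite size_poly_gt0.
have Su : size (u ^+ 2) = (2 * size u).-1.
  by rewrite expr2 size_mul // addnn mul2n.
have Sb : (size (ws_b * u * v)%R <= size u + size v)%N.
  apply: leq_trans (size_polyMleq _ _) _.
  have := size_polyMleq ws_b u; have := size_ws_b; lia.
have [uv|uv] := leqP (size u) (size v + 1).
  rewrite addrC size_polyDl size_polyN Scv; first by lia.
  by apply: leq_ltn_trans (sizeB _ _) _; rewrite Su; lia.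
rewrite -addrA -opprD size_polyDl Su; first by lia.
by rewrite size_polyN; apply: leq_ltn_trans (sizeD _ _) _; rewrite Scv; lia.
Qed.

(** Otherwise the norm of [h] has degree at least 3. As the norms multiply to [d ^+ 2], of degree at
    most 4, [g] has no [Y]-part; then the [Y]-part of [h * g] is [h.2 * g.1], which is nonzero. *)
Lemma coord_factor (h g : A) (d : {poly F}) :
  d != 0 -> (size d <= 3)%N -> h * g = quad_of _ _ d -> h.2 = 0.
Proof.
move=> d0 d3 Ehg; apply/eqP; apply: contraT => h0.
have [N EN] : exists N : A -> {poly F}, N = @quad_norm _ _ _ by exists (@quad_norm _ _ _).
have SN u : u.2 != 0 -> (3 < size (N u))%N by rewrite EN; apply: size_norm_form.
have ENhg : N h * N g = d ^+ 2.
  by rewrite EN -quad_normM Ehg /quad_norm /=; ring.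
have sizeM (r s : {poly F}) : r != 0 -> s != 0 -> size (r * s) = (size r + size s).-1.
  exact: size_mul.
have Sd : size (N h * N g) = (size d + size d).-1 by rewrite ENhg expr2 sizeM.
have : N h * N g != 0 by rewrite ENhg expf_neq0.
rewrite mulf_eq0 negb_or => /andP[Nh0 Ng0].
rewrite sizeM // in Sd; have Sh := SN h h0.
have g0 : g.2 = 0 by apply/eqP; apply: contraT => /SN; lia.
have Ng : N g = g.1 * g.1 by rewrite EN /quad_norm g0; ring.
have g10 : g.1 != 0 by apply: contra Ng0 => /eqP g10; rewrite Ng g10 mul0r.
have : (h * g).2 = 0 by rewrite Ehg.
rewrite quad_mulE /= g0 => /eqP.
by rewrite !(mulr0, mul0r, subr0, add0r) mulf_eq0 (negPf g10) (negPf h0).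
Qed.

Definition coord_eval (x y : F) (u : A) : F := u.1.[x] + u.2.[x] * y.

Lemma coord_evalM x y u v : on_curve E (Some (x, y)) ->
  coord_eval x y (u * v) = coord_eval x y u * coord_eval x y v.
Proof.
move=> /= Exy; rewrite /coord_eval quad_mulE /= !hornerE.
apply: subr0_eq; transitivity (u.2.[x] * v.2.[x] *
  (x ^+ 3 + a2 * x ^+ 2 + a4 * x + a6 - (y ^+ 2 + a1 * x * y + a3 * y))).
  by rewrite /ws_b /ws_c !hornerE; ring.
by rewrite Exy subrr mulr0.
Qed.

Lemma coord_eval_ideal x y s u : on_curve E (Some (x, y)) ->
  (forall v, v \in s -> coord_eval x y v = 0) ->
  in_ideal s u -> coord_eval x y u = 0.
Proof.
move=> Exy Es; move: u; apply: in_ideal_ind => //.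
- by rewrite /coord_eval /= !hornerE.
- move=> v w; rewrite /coord_eval /= !hornerE => Ev Ew.
  by rewrite -[RHS]addr0 -{1}Ev -{1}Ew; ring.
- by move=> k v Ev; rewrite coord_evalM // Ev mulr0.
Qed.

Local Notation pid := (pt_ideal i X Y).

(** A generator divides [X - i x], hence is a polynomial in [X] alone, vanishing at [x]. The
    [Y]-parts of its multiples vanish at [x] too, but that of [Y - i y] is 1. *)
Lemma pt_ideal_not_principal x y : on_curve E (Some (x, y)) ->
  ~ ideal_equiv (pid (Some (x, y))) [:: 1].
Proof.
move=> Exy /ideal_equiv_principal[h hI hP].
have [|k Ek] := hP (X - i x); first exact/in_ideal_mem/mem_head.
have h2 : h.2 = 0.
  apply: (@coord_factor h k ('X - x%:P)); rewrite ?polyXsubC_eq0 ?size_XsubC //.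
  by rewrite -Ek rmorphB.
have hx : h.1.[x] = 0.
  have : coord_eval x y h = 0.
    apply: coord_eval_ideal hI => // v; rewrite !inE => /orP[] /eqP->;
    by rewrite /coord_eval /= !hornerE; ring.
  by rewrite /coord_eval h2 !hornerE.
have [|l El] := hP (Y - i y); first by apply: in_ideal_mem; rewrite !inE eqxx orbT.
have : (Y - i y).2.[x] = (h * l).2.[x] by rewrite -El.
rewrite quad_mulE /= h2 !hornerE hx => /eqP.
by rewrite !(mul0r, addr0, subr0) oner_eq0.
Qed.

(** As before, a generator is a polynomial in [X] vanishing at [x], so all [Y]-parts in the ideal
    vanish at [x]. Those of two products of generators yield [x = x'] and the formula for [y']. *)
Lemma pt_ideal_mul_principal x y x' y' :
  on_curve E (Some (x, y)) -> on_curve E (Some (x', y')) ->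
  ideal_equiv (idealM (pid (Some (x, y))) (pid (Some (x', y')))) [:: 1] ->
  Some (x', y') = ptopp E (Some (x, y)).
Proof.
move=> Exy Exy' /ideal_equiv_principal[h hI hP].
have IX z w : in_ideal (pid (Some (z, w))) (X - i z) by exact/in_ideal_mem/mem_head.
have IY z w : in_ideal (pid (Some (z, w))) (Y - i w).
  by apply: in_ideal_mem; rewrite !inE eqxx orbT.
have [k Ek] := hP _ (in_idealM (IX x y) (IX x' y')).
have h2 : h.2 = 0.
  apply: (@coord_factor h k (('X - x%:P) * ('X - x'%:P))).
  - by rewrite mulf_neq0 ?polyXsubC_eq0.
  - by rewrite size_mul ?polyXsubC_eq0 // !size_XsubC.
  - by rewrite -Ek rmorphM !rmorphB.
have hx : h.1.[x] = 0.
  have : coord_eval x y h = 0.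
    apply: coord_eval_ideal hI => // v /allpairsP[[u w] /= [+ _ ->]].
    by rewrite !inE coord_evalM // => /orP[] /eqP->;
      rewrite /coord_eval /= !hornerE; ring.
  by rewrite /coord_eval h2 !hornerE.
have snd_h u : in_ideal (idealM (pid (Some (x, y))) (pid (Some (x', y')))) u ->
    u.2.[x] = 0.
  by move/hP=> [l ->]; rewrite quad_mulE /= h2 !hornerE hx; ring.
have Ex : x = x'.
  have := snd_h _ (in_idealM (IY x y) (IX x' y')).
  rewrite quad_mulE /= !hornerE => E0; apply: subr0_eq; rewrite -[RHS]E0; ring.
congr (Some (_, _)); first by rewrite Ex.
have := snd_h _ (in_idealM (IY x y) (IY x' y')).
rewrite quad_mulE /= /ws_b !hornerE => E0; apply: subr0_eq.
by rewrite -[RHS]oppr0 -[in RHS]E0; ring.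
Qed.

Lemma ptoppK : involutive (ptopp E).
Proof. by case=> [[x y]|] //=; congr (Some (_, _)); ring. Qed.

Lemma coord_vert_reg x : GRing.lreg (X - i x : A).
Proof.
have -> : X - i x = quad_of _ _ ('X - x%:P) by rewrite rmorphB.
apply/quad_norm_lreg/mulfI; rewrite /quad_norm /= mulr0 expr0n mulr0 !subr0.
by rewrite expf_neq0 ?polyXsubC_eq0.
Qed.

Lemma coord_line_reg l m : GRing.lreg (Y - i l * X - i m : A).
Proof.
apply/quad_norm_lreg/mulfI; rewrite -size_poly_gt0.
apply: ltn_trans (size_norm_form _ _) => //=.
by rewrite mulr0 mul0r !(subr0, addr0, mul0r) oner_eq0.
Qed.

Hypothesis E_ell : elliptic E.

Let pid_opp P (P_on : on_curve E P) :=
  pt_ideal_opp coord_curve coord_vert_reg E_ell P_on.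
Let pid_add P Q (P_on : on_curve E P) (Q_on : on_curve E Q) :=
  pt_ideal_add coord_curve coord_vert_reg coord_line_reg E_ell P_on Q_on.

(** Multiplying by the ideal of the opposite of [Q] makes the class trivial, so the opposites of [P]
    and [Q] agree. *)
Lemma pt_ideal_inj P Q : on_curve E P -> on_curve E Q ->
  ideal_equiv (pid P) (pid Q) -> P = Q.
Proof.
case: Q => [[x' y']|]; last first.
  by case: P => // -[x y] P_on _ /pt_ideal_not_principal[].
case: P => [[x y]|] P_on Q_on PQ; last first.
  by case: (pt_ideal_not_principal Q_on); apply: ideal_equiv_sym.
have PQ1 := ideal_equiv_trans (ideal_equivMl _ PQ) (pid_opp Q_on).
have := pt_ideal_mul_principal P_on (on_curve_opp Q_on) PQ1.
by rewrite -/(ptopp E (Some (x', y'))) => /(inv_inj ptoppK).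
Qed.

Lemma ptaddC P Q : on_curve E P -> on_curve E Q -> ptadd E P Q = ptadd E Q P.
Proof.
move=> P_on Q_on; apply: pt_ideal_inj; try exact: on_curve_add.
apply: ideal_equiv_trans (ideal_equiv_sym (pid_add P_on Q_on)) _.
exact: ideal_equiv_trans (ideal_equivMC _ _) (pid_add Q_on P_on).
Qed.

Lemma ptaddA P Q S : on_curve E P -> on_curve E Q -> on_curve E S ->
  ptadd E P (ptadd E Q S) = ptadd E (ptadd E P Q) S.
Proof.
move=> P_on Q_on S_on; have PQ_on := on_curve_add P_on Q_on.
have QS_on := on_curve_add Q_on S_on.
apply: pt_ideal_inj; try exact: on_curve_add.
apply: ideal_equiv_trans (ideal_equiv_sym (pid_add P_on QS_on)) _.
apply: ideal_equiv_trans (pid_add PQ_on S_on).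
apply: ideal_equiv_trans (ideal_equivMr _ (ideal_equiv_sym (pid_add Q_on S_on))) _.
apply: ideal_equiv_trans (ideal_equivMA _ _ _) _.
exact: ideal_equivMl (pid_add P_on Q_on).
Qed.

Lemma ptaddN P : on_curve E P -> ptadd E (ptopp E P) P = None.
Proof.
case: P => [[x y]|] //= _; rewrite eqxx /=.
by rewrite (_ : _ + _ = 0) ?eqxx //; ring.
Qed.

End Jacobian.

(** * The group of points *)

Definition on_curveb (F : fieldType) (E : weierstrass F) (P : point F) : bool :=
  if P is Some (x, y) then
    y ^+ 2 + wa1 E * x * y + wa3 E * y ==
      x ^+ 3 + wa2 E * x ^+ 2 + wa4 E * x + wa6 E
  else true.

Lemma on_curveP (F : fieldType) (E : weierstrass F) P :
  reflect (on_curve E P) (on_curveb E P).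
Proof. by case: P => [[x y]|] /=; [apply: eqP | left]. Qed.

(* The proof of [elliptic E] is a parameter of the type so that the group
   structure can be inferred from it. *)
Definition curve_point (F : fieldType) (E : weierstrass F) of elliptic E : Type :=
  {P : option (F * F) | on_curveb E P}.

Section CurveGroup.
Variables (F : fieldType) (E : weierstrass F) (E_ell : elliptic E).
Local Notation T := (curve_point E_ell).

HB.instance Definition _ := [isSub of T for @sval _ (on_curveb E)].
HB.instance Definition _ := [Choice of T by <:].

Lemma curve_pointP (P : T) : on_curve E (val P).
Proof. exact/on_curveP/valP. Qed.

Definition to_curve P (P_on : on_curve E P) : T := exist _ P (introT (on_curveP E P) P_on).

Definition curve_zero : T := @to_curve None I.
Definition curve_opp (P : T) : T := to_curve (on_curve_opp (curve_pointP P)).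
Definition curve_add (P Q : T) : T :=
  to_curve (on_curve_add (curve_pointP P) (curve_pointP Q)).

Fact curve_addA : associative curve_add.
Proof. by move=> P Q S; apply/val_inj/ptaddA => //; apply: curve_pointP. Qed.
Fact curve_addC : commutative curve_add.
Proof. by move=> P Q; apply/val_inj/ptaddC => //; apply: curve_pointP. Qed.
Fact curve_add0 : left_id curve_zero curve_add.
Proof. by move=> P; apply: val_inj. Qed.
Fact curve_addN : left_inverse curve_zero curve_opp curve_add.
Proof. by move=> P; apply/val_inj/ptaddN/curve_pointP. Qed.

HB.instance Definition _ :=
  GRing.isZmodule.Build T curve_addA curve_addC curve_add0 curve_addN.

Lemma val_curveD (P Q : T) : val (P + Q) = ptadd E (val P) (val Q).
Proof. by []. Qed.

Lemma val_curveMn (P : T) n : val (P *+ n) = ptmul E n (val P).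
Proof. by elim: n => // n IHn; rewrite mulrS val_curveD IHn. Qed.

(** * The coset of [R] modulo the multiples of [t] *)

Section Coset.
Variables (t R : T) (n : nat).
Hypotheses (t_order : has_order E (val t) n) (nR_neq0 : R *+ n != 0).

Lemma order_mulrn : t *+ n = 0.
Proof. by apply: val_inj; rewrite val_curveMn; case: t_order. Qed.

(** Multiplication by [n] sends every [R + t *+ j] to [R *+ n], which is nonzero. *)
Lemma coset_not_torsion (Q : T) j : Q *+ n = 0 -> R + t *+ j != Q.
Proof.
move=> Qn0; apply: contra nR_neq0 => /eqP/(congr1 (fun P => P *+ n)).
by rewrite mulrnDl -mulrnA mulnC mulrnA order_mulrn mul0rn addr0 Qn0 => ->.
Qed.

Lemma coset_inj : injective (fun j : 'I_n => R + t *+ j).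
Proof.
suff le_inj (j k : 'I_n) : (j <= k)%N -> R + t *+ j = R + t *+ k -> j = k.
  by move=> j k; case/orP: (leq_total j k) => jk E_jk;
    [|apply/esym]; apply: le_inj.
move=> jk /addrI E_jk; apply: val_inj; apply/eqP; rewrite eqn_leq jk /= leqNgt.
apply/negP => lt_jk; case: t_order => _ _ /(_ (k - j)%N) [|].
  by rewrite subn_gt0 lt_jk (leq_ltn_trans (leq_subr _ _)).
by rewrite -val_curveMn mulrnBr // E_jk subrr.
Qed.

End Coset.
End CurveGroup.

(** * Counting zero entries: roots of a quadratic, weights and cyclic shifts *)

Lemma card_quadratic_root_le (F : fieldType) (I : finType) (A : {set I}) (f : I -> F)
    (u v : F) :
  {in A &, injective f} -> (forall j, j \in A -> f j ^+ 2 + u * f j + v = 0) ->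
  (#|A| <= 2)%N.
Proof.
move=> f_inj f0; pose p : {poly F} := 'X^2 + (u%:P * 'X + v%:P).
have Sp : size p = 3%N.
  rewrite size_polyDl size_polyXn // ltnS.
  by apply/leq_sizeP => [[|[|j]]] // _; rewrite !coefE /= mulr0 addr0.
rewrite -ltnS -Sp cardE -(size_map f); apply: max_poly_roots.
- by rewrite -size_poly_gt0 Sp.
- apply/allP => _ /mapP[j + ->]; rewrite mem_enum => /f0 fj.
  by rewrite rootE /p !hornerE; apply/eqP/fj.
by rewrite map_inj_in_uniq ?enum_uniq // => j k; rewrite !mem_enum; apply: f_inj.
Qed.

Section Weights.
Variables (F : fieldType) (n : nat).
Implicit Type v : 'rV[F]_n.

Lemma weightE v : weight v = (n - num_zeros v)%N.
Proof.
have := cardsC [set j | v 0 j == 0]; rewrite card_ord => En.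
rewrite /num_zeros -[X in (X - _)%N]En addKn.
by apply: eq_card => j; rewrite !inE.
Qed.

(** A zero of the product lies in the zero set of [v] or in its preimage under the shift, a
    bijection. *)
Lemma num_zeros_shift_prod k v : (num_zeros (shift_prod k v) <= 2 * num_zeros v)%N.
Proof.
pose Z := [set j | v 0 j == 0]; pose s := iter k (@ord_pred n).
have s_inj : injective s.
  by rewrite /s; elim: k {s} => // k IHk i j /= /ord_pred_inj; apply: IHk.
apply: leq_trans (_ : #|Z :|: s @^-1: Z| <= _)%N.
  by apply/subset_leq_card/subsetP => j; rewrite !inE mxE mulf_eq0.
rewrite mul2n -addnn; apply: leq_trans (leq_card_setU _ _) _.
by rewrite card_preimset.
Qed.

End Weights.

Lemma eq_abscissa (F : fieldType) (E : weierstrass F) x y y' :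
  on_curve E (Some (x, y)) -> on_curve E (Some (x, y')) ->
  y = y' \/ Some (x, y) = ptopp E (Some (x, y')).
Proof.
move=> /= E1 E2.
have /eqP : (y - y') * (y - (- y' - wa1 E * x - wa3 E)) = 0.
  transitivity ((y ^+ 2 + wa1 E * x * y + wa3 E * y) -
    (y' ^+ 2 + wa1 E * x * y' + wa3 E * y')); first ring.
  by rewrite E1 E2 subrr.
by rewrite mulf_eq0 !subr_eq0 => /orP[] /eqP ->; [left | right].
Qed.

Theorem proposition3
    (p q n : nat) (F : finFieldType) (E : weierstrass F)
    (t R : point F) (a b c : F)
    (p_prime : prime p)
    (q_pow : exists2 m : nat, (0 < m)%N & q = (p ^ m)%N)
    (cardF : #|F| = q)
    (n_ge2 : (2 <= n)%N)
    (n_q_le : (n_q n q)%:R <= sqrtC (q%:R) :> algC)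
    (E_ell : elliptic E)
    (t_on : on_curve E t)
    (t_order : has_order E t n)
    (R_on : on_curve E R)
    (nR_neq0 : ptmul E n R <> None)
    (c_const : is_ell_const E n t c)
    (a_neq0 : a != 0)
    (ab_eq : a * c + n%:R * b = 1) :
  [/\ (n - 2 <= weight (vecRx n E t R))%N,
      (n - 2 <= weight (vecR n E t R a b))%N
    & forall k : nat, (k <= n - 1)%N ->
        (num_zeros (vecR n E t R a b) = 1%N ->
           (n - 2 <= weight (shift_prod k (vecR n E t R a b)))%N) /\
        (num_zeros (vecR n E t R a b) = 2%N ->
           (n - 4 <= weight (shift_prod k (vecR n E t R a b)))%N)].
Proof.
pose t' := to_curve E_ell t_on; pose R' := to_curve E_ell R_on.
have R'n0 : R' *+ n != 0.
  by apply/eqP => /(congr1 val); rewrite val_curveMn; apply: nR_neq0.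
pose P j := ptadd E R (ptmul E j t).
have valP j : P j = val (R' + t' *+ j) by rewrite val_curveD val_curveMn.
have P_on j : on_curve E (P j) by rewrite valP; apply: curve_pointP.
have P_inj (j k : 'I_n) : P j = P k -> j = k.
  by rewrite !valP => /val_inj; apply: (@coset_inj _ _ _ t' R' n).
have P_notin j (Q : curve_point E_ell) : Q *+ n = 0 -> P j <> val Q.
  by move=> Qn0; rewrite valP => /val_inj; apply/eqP/(@coset_not_torsion _ _ _ t' R' n).
have P_affine j : P j = Some (xcoord (P j), ycoord (P j)).
  by case E_P: (P j) => [[x y]|] //; case: (@P_notin j 0); rewrite ?mul0rn.
have zerosRx : (num_zeros (vecRx n E t R) <= 2)%N.
  (* At abscissa 0 the curve equation is a monic quadratic in the ordinate. *)
  apply: (@card_quadratic_root_le _ _ _ (fun j : 'I_n => ycoord (P j)) (wa3 E) (- wa6 E)).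
    move=> j k; rewrite !inE !mxE => /eqP xj /eqP xk yjk; apply: P_inj.
    by rewrite (P_affine j) (P_affine k) yjk [xcoord (P j)]xj [xcoord (P k)]xk.
  move=> j; rewrite inE mxE => /eqP xj; have := P_on j.
  rewrite P_affine [xcoord (P j)]xj /= => Ej.
  by rewrite -[RHS](subrr (0 ^+ 3 + wa2 E * 0 ^+ 2 + wa4 E * 0 + wa6 E)) -{1}Ej; ring.
have zerosR : (num_zeros (vecR n E t R a b) <= 2)%N.
  (* The point [- t] is affine, since the order of [t] is at least 2. *)
  have [x0 [y0 Et]] : exists x0 y0, ptopp E t = Some (x0, y0).
    case: t_order => _ _ /(_ 1%N n_ge2); rewrite /ptmul /=.
    by case: (t) => [[x y]|] // _; exists x; eexists.
  have t_on' : on_curve E (Some (x0, y0)) by rewrite -Et; apply: on_curve_opp.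
  have t'n0 : t' *+ n = 0 by apply: order_mulrn.
  (* The denominator of [ell_f] is never 0, so the default value of division does not occur. *)
  have x_neq j : xcoord (P j) - x0 != 0.
    rewrite subr_eq0; apply/eqP => Ex; have := P_on j; have := P_affine j.
    rewrite Ex => EP; rewrite EP => Pj_on.
    have [Ey|Ey] := eq_abscissa Pj_on t_on'.
      by case: (@P_notin j (- t')); rewrite ?mulNrn ?t'n0 ?oppr0 // EP Ey -Et.
    by case: (@P_notin j t') => //; rewrite EP Ey -Et ptoppK.
  (* An entry is zero exactly when the slope of the line through [P j] and [- t] is [l]. *)
  pose l := - b / a.
  have on_line (j : 'I_n) : j \in [set j | vecR n E t R a b 0 j == 0] ->
      ycoord (P j) = l * (xcoord (P j) - x0) + y0.
    rewrite inE mxE -/(P j) /ell_f /ptsub /= Et.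
    have -> : ptadd E (P j) None = P j by case: (P j) => [[]|].
    rewrite addr_eq0 /= => /eqP Eb; rewrite /l -Eb.
    by rewrite [a * _]mulrC mulfK // divfK // subrK.
  (* The quotient by [X - x0] of the cubic cut out by the line of slope [l] through [- t]. *)
  apply: (@card_quadratic_root_le _ _ _ (fun j : 'I_n => xcoord (P j))
    (x0 + wa2 E - l ^+ 2 - wa1 E * l)
    (x0 ^+ 2 + wa2 E * x0 + wa4 E - 2 * l * y0 + l ^+ 2 * x0 - wa1 E * y0 - wa3 E * l)).
    move=> j k /on_line yj /on_line yk xjk; apply: P_inj.
    by rewrite (P_affine j) (P_affine k) yj yk xjk.
  move=> j /on_line yj; have := P_on j; rewrite P_affine yj /= => Ej.
  apply: (mulfI (x_neq j)); rewrite mulr0.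
  move: Ej t_on' => /= /eqP; rewrite -subr_eq0 => /eqP Ej /eqP.
  rewrite -subr_eq0 => /eqP E0.
  by rewrite -[RHS](subrr 0) -{1}E0 -Ej; ring.
split.
- by rewrite weightE leq_sub2l.
- by rewrite weightE leq_sub2l.
move=> k _; have H := num_zeros_shift_prod k (vecR n E t R a b).
by rewrite weightE; split=> Ez; rewrite leq_sub2l //; move: H; rewrite Ez.
Qed.
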